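(* For every $K\in\mathcal{K}_0^n$ we have $K^{\clubsuit}\in\mathcal{F}^n$. Moreover, the map $\clubsuit:\mathcal{K}_0^n\to\mathcal{F}^n$, $K\mapsto K^{\clubsuit}$, is one to one and onto. Equivalently, every flower $A\in\mathcal{F}^n$ is of the form $A=K^{\clubsuit}$ for a unique $K\in\mathcal{K}_0^n$; and for this $K$ we have $A=\bigcup_{x\in K}B\left(\frac{x}{2},\frac{|x|}{2}\right)$.
   Context: A convex body in $\mathbb{R}^n$ is a closed convex set $K\subseteq\mathbb{R}^n$ with $0\in K$ (not assumed compact, nor with non-empty interior); $\mathcal{K}_0^n$ is the set of all convex bodies. The support function of $K$ is $h_K:S^{n-1}\to[0,\infty]$, $h_K(\theta)=\sup_{x\in K}\langle x,\theta\rangle$. A star set is a non-empty $A\subseteq\mathbb{R}^n$ such that $x\in A$ and $0\le\lambda\le1$ imply $\lambda x\in A$; its radial function is $r_A:S^{n-1}\to[0,\infty]$, $r_A(\theta)=\sup\{\lambda\ge0:\lambda\theta\in A\}$. A star body is a star set $A$ that is radially closed: $r_A(\theta)\theta\in A$ for all $\theta\in S^{n-1}$ with $r_A(\theta)<\infty$; a star body is uniquely determined by $r_A$. For $K\in\mathcal{K}_0^n$, $K^{\clubsuit}$ denotes the star body with radial function $r_{K^{\clubsuit}}=h_K$. $B(y,r)$ is the closed Euclidean ball with center $y$ and radius $r\ge0$. A star body $A\subseteq\mathbb{R}^n$ is a flower if $A=\bigcup_{x\in C}B\left(\frac{x}{2},\frac{|x|}{2}\right)$ for some closed set $C\subseteq\mathbb{R}^n$;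 $\mathcal{F}^n$ is the class of all flowers in $\mathbb{R}^n$.
   Formalization: A flower here is the radial closure of a union of balls over a closed C, since K♣ need not be a plain union for unbounded K; the last equality holds up to radial closure, and exactly if A is a plain union; K♣ is a plain union for compact K. *)

(* Defs.v *)
From HB Require Import structures.
From mathcomp Require Import all_boot all_order all_algebra.
From mathcomp Require Import all_classical all_reals all_analysis.

Set Implicit Arguments.
Unset Strict Implicit.
Unset Printing Implicit Defensive.

Import Order.TTheory GRing.Theory Num.Theory.
Import numFieldNormedType.Exports.

Local Open Scope classical_set_scope.
Local Open Scope ring_scope.

Section Definitions.
Context {R : realType} {n : nat}.
Implicit Types (x y theta : 'rV[R]_n) (A C K : set 'rV[R]_n).

Definition dot x y : R := \sum_(i < n) x 0 i * y 0 i.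

(* The library norm on ['rV[R]_n] is the sup norm; it induces the same topology,
   so [closed] and [compact] below have their Euclidean meaning. *)
Definition enorm x : R := Num.sqrt (dot x x).

Definition unit_sphere : set 'rV[R]_n := [set theta | enorm theta = 1].

Definition eball y (r : R) : set 'rV[R]_n := [set z | enorm (z - y) <= r].

(* [supp] and [radial] take a vector argument; only their values on
   [unit_sphere] are ever used. *)
Definition supp K theta : \bar R := ereal_sup [set (dot x theta)%:E | x in K].

Definition radial A theta : \bar R :=
  ereal_sup [set l%:E | l in [set l : R | 0 <= l /\ A (l *: theta)]].

Definition convex_body : set (set 'rV[R]_n) :=
  [set K : set 'rV[R]_n | [/\ closed K, convex_set K & K 0]].

Definition star_set A : Prop :=
  A !=set0 /\ forall x (l : R), A x -> 0 <= l <= 1 -> A (l *: x).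

Definition radially_closed A : Prop :=
  forall theta, unit_sphere theta ->
    (radial A theta < +oo)%E -> A (fine (radial A theta) *: theta).

Definition star_body A : Prop := star_set A /\ radially_closed A.

(* The star body with radial function [supp K]: see [clubsuit_star_body],
   [radial_clubsuit] and [star_body_inj] below. *)
Definition clubsuit K : set 'rV[R]_n :=
  [set y | y = 0 \/ exists theta (l : R),
    [/\ unit_sphere theta, 0 <= l, (l%:E <= supp K theta)%E & y = l *: theta]].

Definition ball_union C : set 'rV[R]_n :=
  \bigcup_(x in C) eball (2^-1 *: x) (enorm x / 2).

(* For a star set [A], the least star body containing [A]; it has the same
   radial function as [A]. *)
Definition radial_closure A : set 'rV[R]_n :=
  A `|` [set y | exists theta (r : R),
    [/\ unit_sphere theta, radial A theta = r%:E & y = r *: theta]].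

(* [ball_union C] need not be radially closed, even for a closed convex [C]
   containing 0.  In the plane let C = {(a, b) : 0 <= a, (1 - b)(1 + a) >= 1}:
   the supremum supp C (0, 1) = 1 is not attained, so [ball_union C] has radius
   1 in the direction (0, 1) and yet misses (0, 1).  It follows that
   [clubsuit C] is not an [exact_flower].  Hence, in the class of star bodies,
   a union of balls is taken up to radial closure, i.e. it denotes the star
   body whose radial function is the supremum of those of the balls; when
   [ball_union C] is already a star body this is [ball_union C] itself. *)
Definition flower : set (set 'rV[R]_n) :=
  [set A | star_body A /\
    exists2 C, closed C & A = radial_closure (ball_union C)].

Definition exact_flower : set (set 'rV[R]_n) :=
  [set A | star_body A /\ exists2 C, closed C & A = ball_union C].

End Definitions.

Section Facts.
Context {R : realType} {n : nat}.
Implicit Types (x y theta : 'rV[R]_n) (A C K : set 'rV[R]_n).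

Lemma dotZl (l : R) x y : dot (l *: x) y = l * dot x y.
Proof. by rewrite /dot mulr_sumr; apply: eq_bigr => i _; rewrite mxE mulrA. Qed.

Lemma dotZr (l : R) x y : dot x (l *: y) = l * dot x y.
Proof. by rewrite /dot mulr_sumr; apply: eq_bigr => i _; rewrite mxE mulrCA. Qed.

Lemma dot_ge0 x : 0 <= dot x x.
Proof. by apply: sumr_ge0 => i _; rewrite -expr2 sqr_ge0. Qed.

Lemma enormZ (l : R) x : enorm (l *: x) = `|l| * enorm x.
Proof.
by rewrite /enorm dotZl dotZr mulrA -expr2 sqrtrM ?sqr_ge0// sqrtr_sqr.
Qed.

Lemma enorm_eq0 x : enorm x = 0 -> x = 0.
Proof.
move=> /eqP; rewrite sqrtr_eq0 => x0.
have /eqP : dot x x = 0 by apply/eqP; rewrite eq_le x0 dot_ge0.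
rewrite psumr_eq0 => [/allP h|i _]; last by rewrite -expr2 sqr_ge0.
apply/rowP => i; rewrite mxE.
by have := h i (mem_index_enum i); rewrite /= mulf_eq0 orbb => /eqP.
Qed.

Lemma polar x : x <> 0 ->
  exists theta, unit_sphere theta /\ x = enorm x *: theta.
Proof.
move=> x0; have nx0 : enorm x != 0 by apply/eqP => /enorm_eq0.
exists ((enorm x)^-1 *: x); split; last by rewrite scalerA divff// scale1r.
by rewrite /unit_sphere/= enormZ normfV ger0_norm ?sqrtr_ge0// mulVf.
Qed.

Lemma star_set0 A : star_set A -> A 0.
Proof.
by case=> -[x Ax] h; have := h x 0 Ax; rewrite scale0r; apply; rewrite lexx ler01.
Qed.

Lemma radial_ge0 A theta : star_set A -> (0 <= radial A theta)%E.
Proof.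
move=> sA; apply: ereal_sup_ubound; exists 0 => //; split => //.
by rewrite scale0r; exact: star_set0.
Qed.

Lemma star_bodyE A theta (l : R) : star_body A -> unit_sphere theta -> 0 <= l ->
  A (l *: theta) <-> (l%:E <= radial A theta)%E.
Proof.
move=> [sA cA] ut l0; split=> [Al|]; first by apply: ereal_sup_ubound; exists l.
have seg (m : R) : l <= m -> A (m *: theta) -> A (l *: theta).
  move=> lm Am; have [m0|m0] := eqVneq m 0.
    have -> : l = 0 by apply/eqP; rewrite eq_le l0 -m0 lm.
    by rewrite scale0r; exact: star_set0.
  have mp : 0 < m by rewrite lt_def m0 (le_trans l0 lm).
  have -> : l *: theta = (l / m) *: (m *: theta) by rewrite scalerA divfK.
  by apply: sA.2 => //; rewrite divr_ge0 ?(ltW mp)//= ler_pdivrMr// mul1r.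
have := radial_ge0 theta sA.
case E : (radial A theta) => [r| |] // r0.
- rewrite lee_fin => lr; apply: (seg r lr).
  by have := cA theta ut; rewrite E /=; apply; rewrite ltry.
- move=> _; have : (l%:E < radial A theta)%E by rewrite E ltry.
  by move=> /ereal_sup_gt[_ [m [m0 Am] <-]]; rewrite lte_fin => /ltW lm; exact: (seg m).
Qed.

Lemma star_body_inj A B : star_body A -> star_body B ->
  (forall theta, unit_sphere theta -> radial A theta = radial B theta) -> A = B.
Proof.
move=> sA sB h; apply/seteqP; split=> x.
- have [->|/eqP x0] := eqVneq x 0; first by move=> _; exact: star_set0 sB.1.
  have [t [ut ->]] := polar x0.
  by move/(star_bodyE sA ut (sqrtr_ge0 _)); rewrite h// => /(star_bodyE sB ut (sqrtr_ge0 _)).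
- have [->|/eqP x0] := eqVneq x 0; first by move=> _; exact: star_set0 sA.1.
  have [t [ut ->]] := polar x0.
  by move/(star_bodyE sB ut (sqrtr_ge0 _)); rewrite -h// => /(star_bodyE sA ut (sqrtr_ge0 _)).
Qed.

Lemma supp_ge0 K theta : K 0 -> (0 <= supp K theta)%E.
Proof.
move=> K0; apply: ereal_sup_ubound; exists 0 => //.
by rewrite -(scale0r theta) dotZl mul0r.
Qed.

Lemma clubsuitE K theta (l : R) : K 0 -> unit_sphere theta -> 0 <= l ->
  clubsuit K (l *: theta) <-> (l%:E <= supp K theta)%E.
Proof.
move=> K0 ut l0; split; last by move=> h; right; exists theta, l.
move=> [|[t [m [u m0 mK]]]] E; move: (congr1 (@enorm R n) E).
  rewrite enormZ ut mulr1 ger0_norm//.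
  rewrite -(scale0r theta) enormZ normr0 mul0r => ->; exact: supp_ge0.
rewrite !enormZ ut u !mulr1 !ger0_norm// => lm; subst m.
have [l00|ln0] := eqVneq l 0; first by rewrite l00; exact: supp_ge0.
suff -> : theta = t by [].
by have := congr1 (fun z => l^-1 *: z) E; rewrite !scalerA mulVf// !scale1r.
Qed.

Lemma radial_clubsuit K theta : K 0 -> unit_sphere theta ->
  radial (clubsuit K) theta = supp K theta.
Proof.
move=> K0 ut; apply/eqP; rewrite eq_le; apply/andP; split.
  by apply: ge_ereal_sup => _ [l [l0 /(clubsuitE K0 ut l0) h] <-].
have := supp_ge0 theta K0; case E : (supp K theta) => [r| |] // r0.
  apply: ereal_sup_ubound; exists r => //; split; first by rewrite -lee_fin.
  by apply/clubsuitE => //; rewrite ?E.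
rewrite leye_eq; apply/eqP/eqyP => r rp; apply: ereal_sup_ubound.
exists r => //; split; [exact: ltW|apply/(clubsuitE K0 ut (ltW rp))].
by rewrite E leey.
Qed.

Lemma clubsuit_star_body K : K 0 -> star_body (clubsuit K).
Proof.
move=> K0; split; [split; first by exists 0; left|].
  move=> _ l [->|[t [m [ut m0 mK ->]]]] /andP[l0 l1]; first by left; rewrite scaler0.
  rewrite scalerA; apply/clubsuitE; rewrite ?mulr_ge0//.
  by apply: le_trans mK; rewrite lee_fin ler_piMl.
move=> t ut; rewrite radial_clubsuit// => h.
have s0 := supp_ge0 t K0; apply/clubsuitE; rewrite ?fine_ge0//.
by rewrite fineK// ge0_fin_numE.
Qed.

End Facts.

(* Main.v *)
Require Import Defs.
From HB Require Import structures.
From mathcomp Require Import all_boot all_order all_algebra.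
From mathcomp Require Import all_classical all_reals all_analysis.
From mathcomp Require Import ring lra.

(** The theorem is a dictionary between three kinds of data: radial functions
    of star bodies, support functions of convex bodies, and unions of balls.

    By Thales' theorem the ball with diameter [0, x] is the set of the y with
    <y, y> <= <x, y> (lemma [eball_half]), so in a unit direction theta it has
    radius max(<x, theta>, 0).  Hence the union of these balls over a nonempty
    set C is a star set whose radial function is the support function of C
    with 0 adjoined (lemma [radial_ball_union]).  The radial closure of a star
    set is a star body with the same radial function, and a star body is
    determined by its radial function; so a flower with centres in C/2 is the
    star body whose radial function is the support function of C and 0.

    For C = K this shows that the image of K is the flower generated by K.
    For surjectivity, given C, the closed convex hull of C and 0 has the right
    support function; it is obtained here as the intersection of the half-spaces
    bounded by the support function (the Wulff shape [wulff]), which is visibly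
    closed and convex, and no hull has to be formed.

    Injectivity says that a closed convex set is recovered from its support
    function (lemma [wulff_supp]).  This is the separation theorem for a point
    and a closed convex set, proved by projecting the point onto the set.

    When the balls over C already form a star body A, the same recovery shows
    that C lies in the convex body K belonging to A, so the balls over C are
    among the balls over K, which in turn stay inside A.  When K is compact
    its suprema are attained, so the balls over K leave no boundary point of A
    uncovered. *)

Import numFieldNormedType.Exports.

Local Open Scope classical_set_scope.
Local Open Scope ring_scope.

Set Implicit Arguments.
Unset Strict Implicit.
Unset Printing Implicit Defensive.

Import Order.TTheory GRing.Theory Num.Theory.

(** * Euclidean scalar product *)

Section EuclideanSpace.
Context {R : realType} {n : nat}.
Implicit Types (x y z theta : 'rV[R]_n) (A C K : set 'rV[R]_n).

Lemma dotC x y : dot x y = dot y x.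
Proof. by apply: eq_bigr => i _; rewrite mulrC. Qed.

Lemma dotDl x y z : dot (x + y) z = dot x z + dot y z.
Proof. by rewrite /dot -big_split; apply: eq_bigr => i _; rewrite mxE mulrDl. Qed.

Lemma dotDr x y z : dot x (y + z) = dot x y + dot x z.
Proof. by rewrite dotC dotDl !(dotC x). Qed.

Lemma dotNl x y : dot (- x) y = - dot x y.
Proof. by rewrite -scaleN1r dotZl mulN1r. Qed.

Lemma dotNr x y : dot x (- y) = - dot x y.
Proof. by rewrite dotC dotNl dotC. Qed.

Lemma dotBl x y z : dot (x - y) z = dot x z - dot y z.
Proof. by rewrite dotDl dotNl. Qed.

Lemma dot0l y : dot 0 y = 0.
Proof. by rewrite -(scale0r y) dotZl mul0r. Qed.

Lemma enorm_ge0 x : 0 <= enorm x.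
Proof. exact: sqrtr_ge0. Qed.

Lemma enorm_sq x : enorm x ^+ 2 = dot x x.
Proof. by rewrite sqr_sqrtr// dot_ge0. Qed.

Lemma dot_unit theta : unit_sphere theta -> dot theta theta = 1.
Proof. by rewrite /unit_sphere/= -enorm_sq => ->; rewrite expr1n. Qed.

Lemma sqr_coord_le_dot x i : x 0 i ^+ 2 <= dot x x.
Proof.
rewrite /dot (bigD1 i)//= -expr2 lerDl.
by apply: sumr_ge0 => j _; rewrite -expr2 sqr_ge0.
Qed.

Lemma continuous_dot (T : topologicalType) (f g : T -> 'rV[R]_n) :
  continuous f -> continuous g -> continuous (fun t => dot (f t) (g t)).
Proof.
move=> cf cg; rewrite /dot.
apply: continuous_big => [|i _ t]; first exact: add_continuous.
have coord (h : T -> 'rV[R]_n) :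
    continuous h -> (fun s => h s 0 i) @ t --> h t 0 i.
  move=> ch; apply: (cvg_comp h (fun v => v 0 i) (ch t)).
  exact: coord_continuous.
by apply: cvgM; exact: coord.
Qed.

Lemma continuous_dotl theta : continuous (dot^~ theta).
Proof.
by apply: continuous_dot => x; [exact: cvg_id | exact: (@cst_continuous _ _ theta)].
Qed.

(** * Projection onto a closed convex set *)

(** The candidates closer to y than a fixed point of K lie in a cube around y, so
    compactness of cubes suffices and K may be unbounded. *)
Lemma closest_point K y : closed K -> K !=set0 ->
  exists2 p, K p & forall x, K x -> dot (p - y) (p - y) <= dot (x - y) (x - y).
Proof.
move=> cK [x0 Kx0]; pose r := enorm (x0 - y).
pose Q := [set v : 'rV[R]_n | forall i, `[y 0 i - r, y 0 i + r]%classic (v 0 i)].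
have inQ x : dot (x - y) (x - y) <= dot (x0 - y) (x0 - y) -> Q x.
  move=> h i; have : `|(x - y) 0 i| <= r.
    rewrite -(ler_pXn2r (n := 2))// ?nnegrE ?enorm_ge0//.
    by rewrite real_normK ?num_real// enorm_sq (le_trans _ h)// sqr_coord_le_dot.
  by rewrite !mxE ler_distl /= in_itv.
have cQ : compact Q.
  apply: (@rV_compact _ _ (fun i => `[y 0 i - r, y 0 i + r]%classic)) => i.
  exact: segment_compact.
have [|||p] := @EVT_min_rV R n (fun x => dot (x - y) (x - y)) (Q `&` K).
- by exists x0; split => //; exact: inQ.
- exact: compact_closedI.
- have cB : continuous (fun x => x - y).
    by move=> x; exact: (@cvgB _ _ _ (nbhs x) _ id (cst y) x y cvg_id (cvg_cst y)).
  by apply: continuous_subspaceT; exact: continuous_dot.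
rewrite inE => -[_ Kp] pmin; exists p => // x Kx.
have [h|/ltW h] := leP (dot (x - y) (x - y)) (dot (x0 - y) (x0 - y)).
  by apply: pmin; rewrite inE; split => //; exact: inQ.
by apply: le_trans h; apply: pmin; rewrite inE; split => //; exact: inQ.
Qed.

(** First variation: moving from p towards x by a fraction t changes the
    squared distance to y by - 2 t <x - p, y - p> + t^2 |x - p|^2, which would
    be negative for small t if <x - p, y - p> were positive. *)
Lemma closest_point_dot_le K y p : convex_set K -> K p ->
  (forall x, K x -> dot (p - y) (p - y) <= dot (x - y) (x - y)) ->
  forall x, K x -> dot x (y - p) <= dot p (y - p).
Proof.
move=> cvK Kp pmin x Kx; set a := dot (x - p) (y - p); set b := dot (x - p) (x - p).
suff: a <= 0 by rewrite /a dotBl; lra.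
have small (t : R) : 0 < t -> t <= 1 -> 2 * a <= t * b.
  move=> t0 t1; have t01 : Itv.spec (Itv.num_sem (R:=R)) (Itv.Real `[0, 1]%Z) t.
    by rewrite /= /Itv.num_sem/= num_real in_itv/= (ltW t0).
  have /set_mem := cvK x p (Itv.mk t01) (mem_set Kx) (mem_set Kp).
  rewrite [X in K X](_ : _ = p + t *: (x - p)); last first.
    rewrite [LHS](_ : _ = t *: x + (1 - t) *: p)//.
    by apply/rowP => i; rewrite !mxE; ring.
  have expand (u v : 'rV[R]_n) :
      dot (- v + t *: u) (- v + t *: u) = dot v v - 2 * t * dot u v + t * (t * dot u u).
    by rewrite !(dotDl, dotDr, dotNl, dotNr, dotZl, dotZr) (dotC v u); ring.
  move=> /pmin; rewrite addrAC -[p - y]opprB expand dotNl dotNr opprK -/a -/b => h.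
  suff : t * (2 * a) <= t * (t * b) by rewrite ler_pM2l.
  lra.
rewrite leNgt; apply/negP => a0.
have b0 : 0 <= b by exact: dot_ge0.
(* t = a / (a + b) lies in ]0, 1] and gives t * b <= a < 2 * a *)
have ab : 0 < a + b by lra.
have := small (a / (a + b)).
rewrite divr_gt0// ler_pdivrMr// mul1r lerDl b0 => /(_ isT isT).
rewrite mulrAC ler_pdivlMr// => h.
nra.
Qed.

(** * Support functions and Wulff shapes *)

(** The Wulff shape (Aleksandrov body) of h: the largest set whose support
    function is at most h on the unit sphere. *)
Definition wulff (h : 'rV[R]_n -> \bar R) : set 'rV[R]_n :=
  [set x | forall theta, unit_sphere theta -> ((dot x theta)%:E <= h theta)%E].

Lemma wulff_convex_body (h : 'rV[R]_n -> \bar R) :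
  (forall theta, unit_sphere theta -> (0 <= h theta)%E) -> convex_body (wulff h).
Proof.
move=> h0; split; last by move=> t ut; rewrite dot0l h0.
- have -> : wulff h = \bigcap_(t in unit_sphere)
      [set x | ((dot x t)%:E <= h t)%E] by apply/seteqP; split=> x Wx t; exact: Wx.
  apply: closed_bigI => t _; case: (h t) => [r| |].
  + rewrite (_ : [set _ | _] = (fun x => dot x t) @^-1` [set s | s <= r]); last first.
      by apply/seteqP; split=> x /=; rewrite lee_fin.
    apply: closed_comp => [x _|]; last exact: closed_le.
    exact: continuous_dotl.
  + rewrite (_ : [set _ | _] = setT); first exact: closedT.
    by apply/seteqP; split=> x //= _; rewrite leey.
  + rewrite (_ : [set _ | _] = set0); first exact: closed0.
    by apply/seteqP; split=> x //=; rewrite leeNy_eq.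
- move=> x y l /set_mem Kx /set_mem Ky; apply/mem_set => t ut.
  rewrite [X in dot X _](_ : _ = l%:num *: x + (1 - l%:num) *: y)//.
  rewrite dotDl !dotZl; move: (Kx t ut) (Ky t ut); case: (h t) => [r| |].
  + rewrite !lee_fin => xr yr.
    have l0 : 0 <= l%:num by []. have l1 : l%:num <= 1 by [].
    nra.
  + by rewrite !leey.
  + by rewrite leeNy_eq.
Qed.

Lemma sub_wulff_supp K : K `<=` wulff (supp K).
Proof. by move=> x Kx t _; apply: ereal_sup_ubound; exists x. Qed.

(** For nonempty K, [wulff (supp K)] is the closed convex hull of K; passing to
    it does not change the support function. *)
Lemma supp_wulff K theta :
  unit_sphere theta -> supp (wulff (supp K)) theta = supp K theta.
Proof.
move=> ut; apply/eqP; rewrite eq_le; apply/andP; split.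
  by apply: ge_ereal_sup => _ [x Wx <-]; exact: Wx.
by apply: ereal_sup_le => _ [x Kx <-]; exists x => //; exact: sub_wulff_supp.
Qed.

(** Separation theorem: if y is outside K and p is its projection, then the
    direction of y - p witnesses that y violates a half-space containing K. *)
Lemma wulff_supp K : closed K -> convex_set K -> K !=set0 -> wulff (supp K) = K.
Proof.
move=> cK cvK K0; apply/seteqP; split; last exact: sub_wulff_supp.
move=> y Wy; have [p Kp pmin] := closest_point y cK K0.
have [-> //|/eqP yp] := eqVneq y p.
have [|t [ut tE]] := polar (x := y - p); first by move/subr0_eq.
have d0 : 0 < enorm (y - p).
  by rewrite lt_def enorm_ge0 andbT; apply/eqP => /enorm_eq0/subr0_eq.
have : ((dot y t)%:E <= (dot p t)%:E)%E.
  apply: le_trans (Wy t ut) _; apply: ge_ereal_sup => _ [x Kx <-].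
  have := closest_point_dot_le cvK Kp pmin Kx.
  by rewrite tE !dotZr ler_pM2l// lee_fin.
have : dot (y - p) t = enorm (y - p) by rewrite tE dotZl dot_unit// mulr1 -tE.
by rewrite dotBl lee_fin; lra.
Qed.

(** * Radial closure of a star set *)

(** Only l equal to the radius needs the points added by the closure; for a
    smaller l the supremum yields a longer vector in A, and A is a star set. *)
Lemma radial_closureE A theta (l : R) : star_set A -> unit_sphere theta -> 0 <= l ->
  radial_closure A (l *: theta) <-> (l%:E <= radial A theta)%E.
Proof.
move=> sA ut l0; split.
  move=> [Al|[t [r [u rE E]]]]; first by apply: ereal_sup_ubound; exists l.
  have r0 : 0 <= r by rewrite -lee_fin -rE radial_ge0.
  have lr : l = r.
    have := congr1 (@enorm R n) E.
    by rewrite !enormZ ut u !mulr1 !ger0_norm.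
  have [->|ln0] := eqVneq l 0; first exact: radial_ge0.
  suff -> : theta = t by rewrite rE lr.
  have := congr1 (fun z => l^-1 *: z) E.
  by rewrite -lr !scalerA mulVf// !scale1r.
rewrite le_eqVlt => /orP[/eqP lE|]; first by right; exists theta, l.
move=> /ereal_sup_gt[_ [m [m0 Am] <-]]; rewrite lte_fin => lm; left.
have mp : 0 < m by exact: le_lt_trans lm.
have -> : l *: theta = (l / m) *: (m *: theta) by rewrite scalerA divfK ?gt_eqF.
by apply: sA.2 => //; rewrite divr_ge0 ?(ltW mp)//= ler_pdivrMr// mul1r ltW.
Qed.

Lemma radial_radial_closure A theta : star_set A -> unit_sphere theta ->
  radial (radial_closure A) theta = radial A theta.
Proof.
move=> sA ut; apply/eqP; rewrite eq_le; apply/andP; split.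
  by apply: ge_ereal_sup => _ [l [l0 /(radial_closureE sA ut l0) h] <-].
by apply: ereal_sup_le => _ [l [l0 Al] <-]; exists l => //; split => //; left.
Qed.

Lemma star_body_radial_closure A : star_set A -> star_body (radial_closure A).
Proof.
move=> sA; split; [split; first by have [x Ax] := sA.1; exists x; left|].
  move=> x l [Ax|[t [r [ut rE ->]]]] /andP[l0 l1].
    by left; apply: sA.2 => //; rewrite l0.
  have r0 : 0 <= r by rewrite -lee_fin -rE radial_ge0.
  rewrite scalerA; apply/radial_closureE; rewrite ?mulr_ge0//.
  by rewrite rE lee_fin ler_piMl.
move=> t ut; rewrite radial_radial_closure// => h.
have r0 := radial_ge0 t sA; apply/radial_closureE; rewrite ?fine_ge0//.
by rewrite fineK// ge0_fin_numE.
Qed.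

Lemma radial_closure_id A : star_body A -> radial_closure A = A.
Proof.
move=> sA; apply: star_body_inj => //; first exact: star_body_radial_closure sA.1.
by move=> t ut; rewrite radial_radial_closure//; exact: sA.1.
Qed.

(** * Unions of balls and flowers *)

(** Thales: in |y - x/2|^2 <= |x|^2/4 the terms in |x|^2 cancel. *)
Lemma eball_half x y : eball (2^-1 *: x) (enorm x / 2) y <-> dot y y <= dot x y.
Proof.
rewrite /eball/= -(ler_pXn2r (n := 2))// ?nnegrE ?divr_ge0 ?enorm_ge0//.
rewrite enorm_sq expr_div_n enorm_sq.
rewrite !(dotDl, dotDr, dotNl, dotNr, dotZl, dotZr) (dotC y x).
by split; lra.
Qed.

Lemma star_set_ball_union C : C !=set0 -> star_set (ball_union C).
Proof.
move=> [c Cc]; split.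
  by exists 0, c => //; apply/eball_half; rewrite dotC !dot0l.
move=> y l [x Cx /eball_half yx] /andP[l0 l1]; exists x => //; apply/eball_half.
rewrite dotZl !dotZr ler_wpM2l//; apply: le_trans yx.
by rewrite ler_piMl// dot_ge0.
Qed.

(** Adjoining 0 accounts for the directions in which <x, theta> is negative on
    all of C: each ball still contains the origin. *)
Lemma radial_ball_union C theta : C !=set0 -> unit_sphere theta ->
  radial (ball_union C) theta = supp (0 |` C) theta.
Proof.
move=> C0 ut; apply/eqP; rewrite eq_le; apply/andP; split.
  apply: ge_ereal_sup => _ [l [l0 [x Cx /eball_half lx]] <-].
  move: lx; rewrite dotZl !dotZr dot_unit// mulr1.
  have [->|ln0] := eqVneq l 0; first by move=> _; apply: supp_ge0; left.
  rewrite ler_pM2l ?lt_def ?ln0// => lx.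
  apply: (@le_trans _ _ (dot x theta)%:E); first by rewrite lee_fin.
  by apply: ereal_sup_ubound; exists x => //; right.
have r0 := radial_ge0 theta (star_set_ball_union C0).
apply: ge_ereal_sup => _ [x [->|Cx] <-]; first by rewrite dot0l.
have [x0|/ltW x0] := leP 0 (dot x theta); last exact: le_trans r0.
apply: ereal_sup_ubound; exists (dot x theta) => //; split => //.
by exists x => //; apply/eball_half; rewrite dotZl !dotZr dot_unit// mulr1.
Qed.

(** Both sides are star bodies with radial function [supp K]. *)
Lemma clubsuit_ball_union K : K 0 -> clubsuit K = radial_closure (ball_union K).
Proof.
move=> K0; have nK : K !=set0 by exists 0.
have sK := star_set_ball_union nK.
apply: star_body_inj; [exact: clubsuit_star_body|exact: star_body_radial_closure|].
move=> t ut; rewrite radial_clubsuit// radial_radial_closure// radial_ball_union//.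
by congr (supp _ t); apply/seteqP; split=> [x|x [->|]//]; right.
Qed.

Lemma wulff_supp_setU0_convex_body C : convex_body (wulff (supp (0 |` C))).
Proof. by apply: wulff_convex_body => t _; apply: supp_ge0; left. Qed.

Lemma clubsuit_wulff_supp C : C !=set0 ->
  clubsuit (wulff (supp (0 |` C))) = radial_closure (ball_union C).
Proof.
move=> nC; have sC := star_set_ball_union nC.
have [_ _ W0] := wulff_supp_setU0_convex_body C.
apply: star_body_inj; [exact: clubsuit_star_body|exact: star_body_radial_closure|].
move=> t ut; rewrite radial_clubsuit// supp_wulff//.
by rewrite radial_radial_closure// radial_ball_union.
Qed.

Lemma clubsuit_inj K L : convex_body K -> convex_body L ->
  clubsuit K = clubsuit L -> K = L.
Proof.
move=> [cK vK K0] [cL vL L0] KL.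
have nK : K !=set0 by exists 0.
have nL : L !=set0 by exists 0.
rewrite -(wulff_supp cK vK nK) -(wulff_supp cL vL nL).
have e t : unit_sphere t -> supp K t = supp L t.
  by move=> ut; rewrite -radial_clubsuit// KL radial_clubsuit.
by apply/seteqP; split=> x Wx t ut; have := Wx t ut; rewrite e.
Qed.

Lemma flower_clubsuit K : convex_body K -> flower (clubsuit K).
Proof.
move=> [cK _ K0]; split; first exact: clubsuit_star_body.
by exists K => //; exact: clubsuit_ball_union.
Qed.

(** An empty union of balls has an empty radial closure, since the supremum
    defining its radial function is -oo and never a real number. *)
Lemma star_body_ball_union_nonempty C :
  star_body (radial_closure (ball_union C)) -> C !=set0.
Proof.
move=> [[[x xA] _] _].
case: xA => [[c Cc _]|[t [r [ut rE _]]]]; first by exists c.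
apply/set0P/eqP => C0; move: rE; rewrite /radial (_ : [set _ | _ in _] = set0).
  by rewrite ereal_sup0.
by apply/seteqP; split=> // e [l [_ [c Cc _]] _]; rewrite C0 in Cc.
Qed.

Lemma flower_clubsuit_surj A : flower A ->
  exists2 K, convex_body K & clubsuit K = A.
Proof.
move=> [sA [C cC AE]]; rewrite AE in sA *.
exists (wulff (supp (0 |` C))); first exact: wulff_supp_setU0_convex_body.
exact/clubsuit_wulff_supp/star_body_ball_union_nonempty.
Qed.

(** The generators C of an exact flower lie in the associated convex body K,
    because K is the Wulff shape of the support function of C and 0. *)
Lemma clubsuit_exact_flower K : convex_body K ->
  exact_flower (clubsuit K) -> clubsuit K = ball_union K.
Proof.
move=> bK [sA [C cC AE]]; have [_ _ K0] := bK.
have sC : star_body (ball_union C) by rewrite -AE.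
have nC : C !=set0.
  by apply: star_body_ball_union_nonempty; rewrite radial_closure_id.
have KE : wulff (supp (0 |` C)) = K.
  apply: clubsuit_inj => //; first exact: wulff_supp_setU0_convex_body.
  by rewrite clubsuit_wulff_supp// AE radial_closure_id.
apply/seteqP; split; last by rewrite clubsuit_ball_union// => x; left.
rewrite AE => y [x Cx xy]; exists x => //.
by rewrite -KE; apply: sub_wulff_supp; right.
Qed.

Lemma supp_attained K theta : compact K -> K !=set0 ->
  exists2 x, K x & supp K theta = (dot x theta)%:E.
Proof.
move=> cK nK; have [|||x /set_mem Kx xmax] := @EVT_max_rV R n (dot^~ theta) K => //.
  by apply: continuous_subspaceT; exact: continuous_dotl.
exists x => //; apply/eqP; rewrite eq_le; apply/andP; split.
  by apply: ge_ereal_sup => _ [z Kz <-]; rewrite lee_fin xmax// inE.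
by apply: ereal_sup_ubound; exists x.
Qed.

(** A point of norm l in direction theta is covered by the ball over a point of
    K at which <., theta> attains its maximum. *)
Lemma compact_clubsuit_ball_union K : compact K -> K 0 -> clubsuit K = ball_union K.
Proof.
move=> cK K0; apply/seteqP; split; last by rewrite clubsuit_ball_union// => x; left.
move=> _ [->|[t [l [ut l0 lK ->]]]].
  by exists 0 => //; apply/eball_half.
have [|x Kx xE] := supp_attained t cK; first by exists 0.
exists x => //; apply/eball_half; rewrite dotZl !dotZr dot_unit// mulr1.
by rewrite ler_wpM2l// -lee_fin -xE.
Qed.

End EuclideanSpace.

Theorem theorem4 (R : realType) (n : nat) :
  [/\ (forall K : set 'rV[R]_n, convex_body K -> flower (clubsuit K)),
      set_bij (@convex_body R n) (@flower R n) (@clubsuit R n),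
      (forall A : set 'rV[R]_n, flower A ->
         exists! K : set 'rV[R]_n, convex_body K /\ A = clubsuit K) &
      (forall A K : set 'rV[R]_n, flower A -> convex_body K -> A = clubsuit K ->
         [/\ A = radial_closure (ball_union K),
             exact_flower A -> A = ball_union K &
             compact K -> exact_flower A])].
Proof.
split; first exact: flower_clubsuit.
- split; first exact: flower_clubsuit.
  + by move=> K L /set_mem bK /set_mem bL; exact: clubsuit_inj.
  + by move=> A /flower_clubsuit_surj[K bK <-]; exists K.
- move=> A /flower_clubsuit_surj[K bK <-]; exists K; split=> // L [bL].
  exact: clubsuit_inj.
- move=> A K _ bK ->; have [cK _ K0] := bK; split.
  + exact: clubsuit_ball_union.
  + exact: clubsuit_exact_flower.
  + move=> kK; split; first exact: clubsuit_star_body.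
    by exists K => //; exact: compact_clubsuit_ball_union.
Qed.
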